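(* Let $\mathcal{V}\subseteq M_n(\mathbb{K})$ be a non-singular subspace of matrices which satisfies the Commutativity Property. Then the following are equivalent: (a) $\mathcal{V}$ satisfies the Diagonalisability Property; (b) for every non-singular matrix $A\in\mathcal{V}$, the matrices in $A^{-1}\mathcal{V}$ are simultaneously diagonalisable.
   Context: $\mathbb{K}\in\{\mathbb{R},\mathbb{C}\}$; diagonalisability is over $\mathbb{K}$ (by similarity). A subspace of matrices is non-singular if it contains an invertible matrix. A non-singular subspace $\mathcal{V}$ satisfies the Commutativity Property if there exists an invertible $A\in\mathcal{V}$ such that $A^{-1}\mathcal{V}=\{A^{-1}M:M\in\mathcal{V}\}$ is a commuting subspace; it satisfies the Diagonalisability Property if there exists an invertible $B\in\mathcal{V}$ such that all matrices in $B^{-1}\mathcal{V}$ are diagonalisable. *)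

(* Defs.v *)
From mathcomp Require Import all_boot all_order all_algebra.
From mathcomp Require Import reals complex.

Set Implicit Arguments.
Unset Strict Implicit.
Unset Printing Implicit Defensive.

Import GRing.Theory.
Local Open Scope ring_scope.

Variant scalar_kind := RealScalars | ComplexScalars.

Definition scalars (R : realType) (k : scalar_kind) : fieldType :=
  match k with
  | RealScalars => R
  | ComplexScalars => R[i]%C
  end.

Section MatrixSubspaces.
Variables (K : fieldType) (n : nat).
Implicit Types (V W : {vspace 'M[K]_n}) (A : 'M[K]_n).

Definition nonsingular_space V : Prop := exists2 A, A \in V & A \in unitmx.

(* A^-1 V = {A^-1 M : M in V}; the intended meaning requires A \in unitmx,
   since invmx A = A otherwise. *)
Definition lquot A V : {vspace 'M[K]_n} := (linfun (mulmx (invmx A)) @: V)%VS.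

Definition commuting_space W : Prop :=
  forall M N, M \in W -> N \in W -> comm_mx M N.

Definition all_diagonalizable W : Prop :=
  forall M, M \in W -> diagonalizable M.

(* The analogue, for a subspace, of codiagonalizable, which is stated for
   finite sequences of matrices. *)
Definition simultaneously_diagonalizable W : Prop :=
  exists2 P : 'M[K]_n, P \in unitmx &
    forall M, M \in W -> diagonalizable_for P M.

Definition commutativity_property V : Prop :=
  exists A, [/\ A \in V, A \in unitmx & commuting_space (lquot A V)].

Definition diagonalisability_property V : Prop :=
  exists B, [/\ B \in V, B \in unitmx & all_diagonalizable (lquot B V)].

End MatrixSubspaces.

(* Main.v *)
(** If [A^-1 V] is commuting for one invertible [A] in [V], it is so for every
    invertible [B] in [V], since [B^-1 M = (A^-1 B)^-1 (A^-1 M)] and inversion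
    preserves commutation. Hence under the Diagonalisability Property some
    [B^-1 V] is commuting and consists of diagonalisable matrices, so a single
    [P] diagonalises a basis of it, and by linearity all of it. For any other
    invertible [C] in [V], [C^-1 M = (B^-1 C)^-1 (B^-1 M)] is then diagonalised
    by the same [P]. *)

Require Import Defs.
From mathcomp Require Import all_boot all_order all_algebra.
From mathcomp Require Import reals complex.
Import GRing.Theory.
Local Open Scope ring_scope.

Section MatrixLemmas.
Variables (K : fieldType) (n : nat).
Implicit Types (A B M N P : 'M[K]_n) (V W : {vspace 'M[K]_n}).

Lemma comm_mx_inv A M : A \in unitmx -> comm_mx A M -> comm_mx (invmx A) M.
Proof.
move=> uA cAM; rewrite /comm_mx -[RHS](mulKmx uA); congr (_ *m _).
by rewrite !mulmxA cAM mulmxK.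
Qed.

(** Entry [(i, k)] of [A *m invmx A = 1] reads [d 0 i * invmx A i k = (i == k)]. Taking [k = i]
    forces [d 0 i != 0], and then [k = j] kills the off-diagonal entry. *)
Lemma is_diag_mx_inv A : A \in unitmx -> is_diag_mx A -> is_diag_mx (invmx A).
Proof.
move=> uA /diag_mxP[d eA]; apply/is_diag_mxP => i j neq_ij.
have eq1 k : d 0 i * invmx A i k = (i == k)%:R.
  by have /matrixP/(_ i k) := mulmxV uA; rewrite {1}eA mul_diag_mx !mxE.
have di_neq0 : d 0 i != 0.
  apply/eqP => di0; have /eqP := eq1 i.
  by rewrite di0 mul0r eqxx eq_sym oner_eq0.
apply: (mulfI di_neq0); rewrite eq1 mulr0.
by rewrite (negbTE (neq_ij : i != j)).
Qed.

Lemma is_diag_mxM A B : is_diag_mx A -> is_diag_mx B -> is_diag_mx (A *m B).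
Proof.
by move=> /diag_mxP[a ->] /diag_mxP[b ->]; rewrite mulmx_diag diag_mx_is_diag.
Qed.

(** Conjugation by [P] respects products and inverses, so it turns [invmx A *m M] into a quotient of
    two diagonal matrices. *)
Lemma diagonalizable_for_ldiv P A M : P \in unitmx -> A \in unitmx ->
  diagonalizable_for P A -> diagonalizable_for P M ->
  diagonalizable_for P (invmx A *m M).
Proof.
move=> uP uA; rewrite /simmx_to_for !mxpoly.conjumx // => dA dM.
have uPAP : P *m A *m invmx P \in unitmx.
  by rewrite !unitmx_mul unitmx_inv uP uA.
have -> : P *m (invmx A *m M) *m invmx P =
    invmx (P *m A *m invmx P) *m (P *m M *m invmx P).
  apply: (can_inj (mulKmx uPAP)).
  by rewrite mulKVmx // !mulmxA mulmxKV // mulmxK.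
by apply: is_diag_mxM => //; apply: is_diag_mx_inv.
Qed.

(** For a fixed [P], the off-diagonal entries of the conjugate depend linearly on [M], so their
    vanishing can be tested on a basis. *)
Lemma diagonalizable_for_span P W : P \in unitmx ->
  (forall M, M \in vbasis W -> diagonalizable_for P M) ->
  forall M, M \in W -> diagonalizable_for P M.
Proof.
move=> uP dP M /coord_vbasis ->.
rewrite /simmx_to_for mxpoly.conjumx // mulmx_sumr mulmx_suml.
apply/is_diag_mxP => i j neq_ij; rewrite summxE big1 // => k _.
rewrite -scalemxAr -scalemxAl mxE.
have := dP (vbasis W)`_k (mem_nth _ _).
rewrite size_tuple ltn_ord => /(_ isT).
by rewrite /simmx_to_for mxpoly.conjumx // => /is_diag_mxP ->; rewrite ?mulr0.
Qed.

Lemma mem_lquotP A V N :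
  reflect (exists2 M, M \in V & N = invmx A *m M) (N \in lquot A V).
Proof.
by apply: (iffP memv_imgP) => -[M MV ->]; exists M; rewrite ?lfunE.
Qed.

Lemma mem_lquot A V M : M \in V -> invmx A *m M \in lquot A V.
Proof. by move=> MV; apply/mem_lquotP; exists M. Qed.

(** For [B] and [M] in [V], this writes an element of [lquot B V] as a quotient of two elements of
    [lquot A V]. *)
Lemma lquot_rebase A B M : A \in unitmx -> B \in unitmx ->
  invmx B *m M = invmx (invmx A *m B) *m (invmx A *m M).
Proof.
move=> uA uB.
have uAB : invmx A *m B \in unitmx by rewrite unitmx_mul unitmx_inv uA.
by apply: (can_inj (mulKmx uAB)); rewrite mulKVmx // -mulmxA mulKVmx.
Qed.

Lemma commuting_lquot V : commutativity_property V ->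
  forall B, B \in V -> B \in unitmx -> commuting_space (lquot B V).
Proof.
move=> [A [AV uA cA]] B BV uB _ _ /mem_lquotP[M MV ->] /mem_lquotP[N NV ->].
rewrite !(lquot_rebase _ _ _ uA uB).
have uAB : invmx A *m B \in unitmx by rewrite unitmx_mul unitmx_inv uA.
have cV L L' : L \in V -> L' \in V -> comm_mx (invmx A *m L) (invmx A *m L').
  by move=> LV L'V; apply: cA; apply: mem_lquot.
have cI L : L \in V -> comm_mx (invmx (invmx A *m B)) (invmx A *m L).
  by move=> LV; apply: comm_mx_inv => //; apply: cV.
(* Both products share the factor [invmx (invmx A *m B)]; all factors commute pairwise by [cV] and
   [cI]. *)
by apply: comm_mxM; apply/comm_mx_sym/comm_mxM;
  do ?[by [] | exact: cV | exact: cI | exact/comm_mx_sym/cI].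
Qed.

Lemma commuting_simultaneously_diagonalizable W :
  commuting_space W -> all_diagonalizable W -> simultaneously_diagonalizable W.
Proof.
move=> cW dW.
(* [codiagonalizableP] speaks of finite sequences, hence the passage through a basis of [W]. *)
have [|P uP /allP dP] := (codiagonalizableP (vbasis W)).1.
  by split=> [M N /vbasis_mem MW /vbasis_mem NW|M /vbasis_mem];
    [apply: cW | apply: dW].
by exists P => //; apply: diagonalizable_for_span.
Qed.

Lemma simultaneously_diagonalizable_rebase V A B :
  A \in unitmx -> B \in V -> B \in unitmx ->
  simultaneously_diagonalizable (lquot A V) ->
  simultaneously_diagonalizable (lquot B V).
Proof.
move=> uA BV uB [P uP dP]; exists P => // _ /mem_lquotP[M MV ->].
rewrite (lquot_rebase _ _ _ uA uB); apply: diagonalizable_for_ldiv => //.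
- by rewrite unitmx_mul unitmx_inv uA.
- by apply/dP/mem_lquot.
- by apply/dP/mem_lquot.
Qed.

End MatrixLemmas.

Theorem theorem2p7 (R : realType) (k : scalar_kind) (n : nat)
    (V : {vspace 'M[scalars R k]_n})
    (hV : nonsingular_space V)
    (hC : commutativity_property V) :
  diagonalisability_property V <->
  (forall A : 'M[scalars R k]_n, A \in V -> A \in unitmx ->
     simultaneously_diagonalizable (lquot A V)).
Proof.
split=> [[B [BV uB dB]] A AV uA | sdV].
  apply: (simultaneously_diagonalizable_rebase _ _ _ B) => //.
  (* The witness of [hC] may differ from [B], so commutativity is first carried over to
     [lquot B V]. *)
  by apply: commuting_simultaneously_diagonalizable => //; apply: commuting_lquot.
(* Any invertible [B] in [V] serves as witness, the common [P] diagonalising each matrix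
   separately. *)
have [B BV uB] := hV; exists B; split=> // M MW.
by have [P uP dP] := sdV B BV uB; exists P; last exact: dP.
Qed.
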